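(* Let $[a,b]\subset\mathbb{R}$ be a bounded interval with $a<b$, and let $\mathfrak{D}=\sum_{j=0}^{N}p_j(x)\,\partial^j$ be a linear differential operator with polynomial coefficients $p_j(x)=\sum_{i=0}^{k_j}a_{i,j}x^i$, $a_{i,j}\in\mathbb{R}$, $N\ge 1$, with $p_N(x)\neq 0$ for all $x\in[a,b]$. Let $g\in C^N([a,b])$ be real-valued with $\mathfrak{D}g\equiv 0$ on $[a,b]$, and let $m_k=\int_a^b x^k g(x)\,dx$ for $k=0,1,2,\dots$. Then the sequence $\{m_k\}$ satisfies the recurrence relation $$\Bigl((\mathrm{E}-a\,\mathrm{I})^N(\mathrm{E}-b\,\mathrm{I})^N\sum_{j=0}^{N}\sum_{i=0}^{k_j}a_{i,j}(-1)^j(i+k)_j\,\mathrm{E}^{i-j}\Bigr)m_k=0\qquad\text{for all }k\ge 0.$$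
   Context: $\partial=d/dx$. For real sequences indexed by $k\in\{0,1,2,\dots\}$, $\mathrm{E}$ is the shift operator, $\mathrm{E}s_k=s_{k+1}$, and $\mathrm{I}$ is the identity. $(x)_j=x(x-1)\cdots(x-j+1)$ is the falling factorial, $(x)_0=1$. The inner operator sends $\{m_k\}$ to the sequence with $k$-th term $\sum_{j}\sum_i a_{i,j}(-1)^j(i+k)_j\,m_{i+k-j}$; a term with $i+k<j$ has coefficient $(i+k)_j=0$ and is read as $0$. Products of difference operators are compositions, the rightmost being applied first; coefficients depending on $k$ do not commute with $\mathrm{E}$. *)

(* Defs.v *)
From HB Require Import structures.
From mathcomp Require Import all_boot all_order all_algebra.
From mathcomp Require Import all_classical all_reals all_analysis.
Set Implicit Arguments. Unset Strict Implicit. Unset Printing Implicit Defensive.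
Import Order.TTheory GRing.Theory Num.Theory.
Import numFieldNormedType.Exports.
Local Open Scope classical_set_scope.
Local Open Scope ring_scope.

(* The limit of the difference quotient of [f] at [x] is taken along the
   points of [a, b] other than [x]: the derivative is two-sided inside the
   interval and one-sided at its end points, and the values of [f] outside
   [a, b] do not matter. *)
Definition quotient_on (R : realType) (f : R -> R) (x : R) : R -> R :=
  fun y => (f y - f x) / (y - x).

Definition derivable_on (R : realType) (a b : R) (f : R -> R) (x : R) : Prop :=
  cvg (quotient_on f x @ within `[a, b] x^').

(* Only meaningful for [x] in [a, b] with [derivable_on a b f x]. *)
Definition derive_on (R : realType) (a b : R) (f : R -> R) : R -> R :=
  fun x => lim (quotient_on f x @ within `[a, b] x^').

Definition derive_n_on (R : realType) (a b : R) (n : nat) (f : R -> R) :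
  R -> R := iter n (derive_on a b) f.

(* C^n([a, b]); continuity of the derivatives of order less than [n] follows
   from their differentiability. *)
Definition C_on (R : realType) (a b : R) (n : nat) (f : R -> R) : Prop :=
  (forall j, (j < n)%N ->
     {in `[a, b], forall x, derivable_on a b (derive_n_on a b j f) x}) /\
  {within `[a, b], continuous (derive_n_on a b n f)}.

(* p_j(x) = \sum_(i <= d j) c i j x^i; the top coefficient c (d j) j may be 0. *)
Definition diff_coef (R : realType) (d : nat -> nat) (c : nat -> nat -> R)
  (j : nat) : {poly R} := \poly_(i < (d j).+1) c i j.

Definition diff_op_on (R : realType) (a b : R) (N : nat) (p : nat -> {poly R})
  (f : R -> R) : R -> R :=
  fun x => \sum_(j < N.+1) (p j).[x] * derive_n_on a b j f x.

Definition moment (R : realType) (a b : R) (g : R -> R) : R^nat :=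
  fun k => \int[lebesgue_measure]_(x in `[a, b]) (x ^+ k * g x).

(* The operator E - t I. *)
Definition shift_sub (R : realType) (t : R) (s : R^nat) : R^nat :=
  fun k => s k.+1 - t * s k.

(* When i + k < j, the subtraction i + k - j is truncated, but then the
   falling factorial (i + k) ^_ j is 0. *)
Definition inner_op (R : realType) (N : nat) (d : nat -> nat)
  (c : nat -> nat -> R) (s : R^nat) : R^nat :=
  fun k => \sum_(j < N.+1) \sum_(i < (d j).+1)
    c i j * (-1) ^+ j * ((i + k) ^_ j)%:R * s (i + k - j)%N.

(* Main.v *)
(* Let [M p] be the integral of [p * g] over [a, b], so that the k-th moment is
   [M 'X^k].  The inner operator turns it into [M (adjoint 'X^k)], where
   [adjoint] is the formal adjoint of the differential operator, and on
   sequences of the form [L (u * 'X^k)] with [L] linear, E - t I multiplies [u]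
   by ['X - t].  The left-hand side is therefore [M (adjoint w)] with
   [w = ('X - a)^N * ('X - b)^N * 'X^k].  Since [w] vanishes to order N at both
   end points, integrating by parts leaves no boundary terms, and moves the
   differential operator back onto [g], where it gives 0. *)
Require Import Defs.
From HB Require Import structures.
From mathcomp Require Import all_boot all_order all_algebra.
From mathcomp Require Import all_classical all_reals all_analysis.
From mathcomp Require Import ring.
Import Order.TTheory GRing.Theory Num.Theory.
Import numFieldNormedType.Exports.
Local Open Scope classical_set_scope.
Local Open Scope ring_scope.

Section OneSidedDerivative.
Context {R : realType} {a b : R}.
Implicit Types f : R -> R.

(** The increment of [f] is the difference quotient times [y - x], a convergent factor times one
    tending to 0. *)
Lemma derivable_on_continuous f :
  {in `[a, b], forall x, derivable_on a b f x} ->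
  {within `[a, b], continuous f}.
Proof.
move=> df; apply/subspace_continuousP => x xab.
have qx : quotient_on f x y * (y - x) @[y --> within `[a, b] x^'] --> (0 : R).
  rewrite -(mulr0 (lim (quotient_on f x @ within `[a, b] x^'))).
  apply: cvgM; first exact: df xab.
  rewrite -(subrr x); apply: cvgB; last exact: cvg_cst.
  by do 2 apply: cvg_within_filter; exact: cvg_id.
apply/cvgrPdist_lt => e e0; rewrite near_withinE.
move/cvgrPdist_lt: qx => /(_ e e0).
rewrite !near_withinE; apply: filterS => y.
(* The limit of the quotient says nothing about [y = x], where the increment is 0 anyway. *)
have [->|yx] := eqVneq y x; first by move=> _ _; rewrite subrr normr0.
move=> + yab => /(_ isT yab).
by rewrite /quotient_on divfK ?subr_eq0// sub0r normrN distrC.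
Qed.

(** [[a, b]] is a neighbourhood of an interior point, so restricting punctured neighbourhoods to it
    changes nothing. This gives integration by parts the ordinary derivatives it works with. *)
Lemma derivable_on_is_derive f x : x \in `]a, b[ ->
  derivable_on a b f x -> is_derive x 1 f (derive_on a b f x).
Proof.
move=> xab; rewrite /derivable_on /derive_on.
have -> : within `[a, b] x^' = x^'.
  apply/seteqP; split => U; last exact: cvg_within.
  have xab' : \forall y \near x^', `[a, b]%classic y.
    apply: nbhs_dnbhs; have := near_in_itvoo xab.
    by apply: filterS => y; exact: subset_itv_oo_cc.
  move=> UW; have UW' : \forall y \near x^', `[a, b]%classic y -> U y by [].
  by move: xab' UW'; apply: filterS2 => y yab; apply.
move=> cq.
(* The ordinary derivative is a limit in the increment [h], while [quotient_on] uses the end point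
   [y = h + x]. *)
have shiftx : h + x @[h --> 0^'] --> x^'.
  move=> U xU; have : \forall y \near x, y != x -> U y by [].
  rewrite (near_shift 0 x) => xU'.
  have : \forall h \near 0, h != 0 -> U (h + x); last by [].
  apply: filterS xU' => h /=; rewrite subr0 => hU h0; apply: hU.
  by rewrite -subr_eq0 addrK.
have qE : (fun h => h^-1 *: ((f \o shift x) (h *: 1) - f x))
    = (fun h => quotient_on f x (h + x)).
  apply/funext => h.
  by rewrite /quotient_on /= addrK mulrC [h *: 1]mulr1.
split; first by rewrite /derivable qE; apply: cvgP (cvg_comp _ _ shiftx cq).
by rewrite /derive qE; apply: cvg_lim => //; exact: cvg_comp shiftx cq.
Qed.

End OneSidedDerivative.

Lemma Rintegral_sum d (T : measurableType d) (R : realType)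
    (mu : {measure set T -> \bar R}) (D : set T) (I : Type) (s : seq I)
    (f : I -> T -> R) :
  measurable D -> (forall i, mu.-integrable D (EFin \o f i)) ->
  \int[mu]_(x in D) (\sum_(i <- s) f i x) =
    \sum_(i <- s) \int[mu]_(x in D) f i x.
Proof.
move=> mD intf; rewrite /Rintegral sum_fine; last first.
  by move=> i _; apply: integrable_fin_num => //; exact: intf.
congr fine; rewrite -integral_sum//.
by apply: eq_integral => x _; rewrite sumEFin.
Qed.

Section PolynomialIntegral.
Context {R : realType}.

Definition poly_integral (a b : R) (f : R -> R) (p : {poly R}) : R :=
  \int[lebesgue_measure]_(x in `[a, b]) (p.[x] * f x).

Lemma poly_mul_integrable (a b : R) (f : R -> R) (p : {poly R}) :
  {within `[a, b], continuous f} ->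
  lebesgue_measure.-integrable `[a, b] (EFin \o (fun x => p.[x] * f x)).
Proof.
move=> cf; apply: continuous_compact_integrable; first exact: segment_compact.
move=> x; apply: cvgM; last exact: cf.
by apply: continuous_subspaceT; exact: continuous_horner.
Qed.

Lemma poly_integral_is_linear {a b : R} {f : R -> R} :
  {within `[a, b], continuous f} -> scalar (poly_integral a b f).
Proof.
move=> cf k p q; rewrite /poly_integral -RintegralZl//; last first.
  exact: poly_mul_integrable.
rewrite -RintegralD//; last exact: poly_mul_integrable.
  by apply: eq_Rintegral => x _; rewrite hornerD hornerZ mulrDl mulrA.
rewrite (_ : (fun x => _) = fun x => (k *: p).[x] * f x).
  exact: poly_mul_integrable.
by apply/funext => x; rewrite hornerZ mulrA.
Qed.

(** Continuity of [f] is an argument because linearity of the integral relies on integrability. *)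
Definition poly_integral_scalar {a b : R} {f : R -> R}
    (cf : {within `[a, b], continuous f}) : {scalar {poly R}} :=
  HB.pack (poly_integral a b f)
    (GRing.isLinear.Build _ _ _ _ _ (poly_integral_is_linear cf)).

(** The roots of [p] kill the boundary terms. Ordinary derivatives are taken only inside the
    interval; continuity covers the end points. *)
Lemma poly_integral_by_parts (a b : R) (f : R -> R) (p : {poly R}) : a < b ->
  {in `[a, b], forall x, derivable_on a b f x} ->
  {within `[a, b], continuous (derive_on a b f)} ->
  root p a -> root p b ->
  poly_integral a b (derive_on a b f) p = - poly_integral a b f p^`().
Proof.
move=> ab df cdf /rootP pa /rootP pb.
have cp (q : {poly R}) : {within `[a, b], continuous (horner q)}.
  by apply: continuous_subspaceT; exact: continuous_horner.
have derivable_ooLR (h : R -> R) : {within `[a, b], continuous h} ->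
    {in `]a, b[, forall x, derivable h x 1} -> derivable_oo_LRcontinuous h a b.
  by move=> /(continuous_within_itvP _ ab)[_ ha hb] dh; split.
have dfE x : x \in `]a, b[ -> is_derive x 1 f (derive_on a b f x).
  move=> xab; apply: derivable_on_is_derive => //; apply: df.
  exact: subset_itv_oo_cc xab.
rewrite /poly_integral (Rintegration_by_parts (G := f) ab (cp p^`()) _ _ cdf).
- by rewrite pa pb !mul0r subrr sub0r.
- by apply: derivable_ooLR => // x _; have [] := is_derive_poly p x.
- by move=> x _; rewrite derive1E; have [_ ->] := is_derive_poly p x.
- apply: derivable_ooLR; first exact: derivable_on_continuous.
  by move=> x /dfE[].
- by move=> x /dfE[_]; rewrite derive1E.
Qed.

(** Both summands of the product rule for [q * u ^+ n.+1] keep the factor [u ^+ n]. *)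
Lemma dvdp_exp_deriv (p u : {poly R}) n : u ^+ n.+1 %| p -> u ^+ n %| p^`().
Proof.
move=> /dvdpP[q ->].
rewrite derivM deriv_exp dvdp_add//.
  by rewrite exprS mulrA dvdp_mulIr.
by rewrite -mulrnAl mulrA dvdp_mulIr.
Qed.

Lemma C_on_continuous {a b : R} {f : R -> R} {n j : nat} : (j <= n)%N ->
  C_on a b n f -> {within `[a, b], continuous (derive_n_on a b j f)}.
Proof.
rewrite leq_eqVlt => /predU1P[-> []//|jn [df _]].
by apply: derivable_on_continuous; exact: df.
Qed.

Lemma C_on_le {a b : R} {f : R -> R} {n j : nat} : (j <= n)%N ->
  C_on a b n f -> C_on a b j f.
Proof.
move=> jn Cf; split; last exact: C_on_continuous Cf.
by move=> i ij; apply: Cf.1; exact: leq_trans jn.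
Qed.

(** Each integration by parts removes the outermost derivative of [f] and costs [p] one order of
    vanishing at [a] and [b], so [n] orders suffice for [n] steps. *)
Lemma poly_integral_derive_n {a b : R} {f : R -> R} {n : nat} {p : {poly R}} :
  a < b -> C_on a b n f -> (('X - a%:P) * ('X - b%:P)) ^+ n %| p ->
  poly_integral a b (derive_n_on a b n f) p
    = (-1) ^+ n * poly_integral a b f p^`(n).
Proof.
move=> ab; elim: n p => [|n IHn] p Cf pdvd; first by rewrite mul1r.
have [df cf] := Cf.
have root_p x : ('X - x%:P) %| ('X - a%:P) * ('X - b%:P) -> root p x.
  rewrite -dvdp_XsubCl => /dvdp_trans; apply.
  by apply: dvdp_trans pdvd; rewrite exprS dvdp_mulr.
rewrite [derive_n_on _ _ _ _]iterS poly_integral_by_parts//; first last.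
- by apply: root_p; rewrite dvdp_mull.
- by apply: root_p; rewrite dvdp_mulr.
- exact: df.
rewrite IHn; [|exact: C_on_le Cf|exact: dvdp_exp_deriv].
by rewrite derivSn exprS mulN1r mulNr.
Qed.

End PolynomialIntegral.

(** The form [L (u * 'X^k)] is preserved with a new [u], so the lemma can be applied for [b] and
    then again for [a]. *)
Lemma iter_shift_sub_scalar (R : realType) (L : {scalar {poly R}}) (t : R)
    (n : nat) (u : {poly R}) :
  iter n (shift_sub t) (fun k => L (u * 'X^k))
    = fun k => L (('X - t%:P) ^+ n * u * 'X^k).
Proof.
elim: n => [|n IHn]; first by under [RHS]eq_fun do rewrite mul1r.
rewrite iterS IHn; apply/funext => k; rewrite /shift_sub.
rewrite -[t * _]linearZ -linearB/=; congr (L _).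
rewrite -mul_polyC exprS [in RHS]exprS; ring.
Qed.

Section Adjoint.
Context {R : realType}.
Variables (N : nat) (d : nat -> nat) (c : nat -> nat -> R).

Definition adjoint (w : {poly R}) : {poly R} :=
  \sum_(j < N.+1) (-1) ^+ j *: (diff_coef d c j * w)^`(j).

Fact adjoint_is_linear : linear adjoint.
Proof.
move=> k p q; rewrite /adjoint scaler_sumr -big_split/=; apply: eq_bigr => j _.
by rewrite mulrDr -scalerAr derivnD derivnZ scalerDr !scalerA mulrC.
Qed.
HB.instance Definition _ :=
  GRing.isLinear.Build R {poly R} {poly R} _ adjoint adjoint_is_linear.

(** The falling factorial and the index [i + k - j] are those of the [j]-th derivative of
    ['X^(i + k)], including the case [i + k < j], where both sides are 0. *)
Lemma inner_op_scalar (L : {scalar {poly R}}) :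
  inner_op N d c (fun k => L 'X^k) = fun k => L (adjoint 'X^k).
Proof.
apply/funext => k; rewrite /inner_op /adjoint linear_sum/=.
apply: eq_bigr => j _; rewrite linearZ/= /diff_coef poly_def mulr_suml.
rewrite linear_sum linear_sum/= mulr_sumr; apply: eq_bigr => i _.
have -> : c i j *: 'X^i * 'X^k = c i j *: 'X^(i + k) :> {poly R}.
  by rewrite -scalerAl -exprD.
rewrite derivnZ derivnXn linearZ/= raddfMn/= -mulr_natl.
by ring.
Qed.

Lemma poly_integral_adjoint {a b : R} {f : R -> R} {w : {poly R}} :
  a < b -> C_on a b N f -> (('X - a%:P) * ('X - b%:P)) ^+ N %| w ->
  poly_integral a b f (adjoint w) = \int[lebesgue_measure]_(x in `[a, b])
    (w.[x] * diff_op_on a b N (diff_coef d c) f x).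
Proof.
move=> ab Cf w_dvd.
have cf : {within `[a, b], continuous f} := C_on_continuous (leq0n N) Cf.
rewrite -[LHS]/(poly_integral_scalar cf (adjoint w)) linear_sum.
transitivity (\sum_(j < N.+1)
    poly_integral a b (derive_n_on a b j f) (diff_coef d c j * w)).
  apply: eq_bigr => j _; have jN : (j <= N)%N by rewrite -ltnS.
  rewrite linearZ/= (poly_integral_derive_n ab)//; first exact: C_on_le Cf.
  (* The [j]-th term needs vanishing to order [j] only, and [j <= N]. *)
  by apply/dvdp_mull/(dvdp_trans _ w_dvd); exact: dvdp_exp2l.
rewrite -Rintegral_sum//; last first.
  move=> j; apply: poly_mul_integrable; apply: C_on_continuous Cf.
  by rewrite -ltnS.
apply: eq_Rintegral => x _; rewrite /diff_op_on mulr_sumr.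
by apply: eq_bigr => j _; rewrite hornerM mulrCA mulrA.
Qed.

End Adjoint.

Theorem theorem2p9 (R : realType) (a b : R) (hab : a < b)
  (N : nat) (hN : (1 <= N)%N)
  (d : nat -> nat) (c : nat -> nat -> R)
  (hpN : {in `[a, b], forall x : R, (diff_coef d c N).[x] != 0})
  (g : R -> R) (hg : C_on a b N g)
  (hDg : {in `[a, b], forall x : R, diff_op_on a b N (diff_coef d c) g x = 0}) :
  forall k : nat,
    iter N (shift_sub a) (iter N (shift_sub b)
      (inner_op N d c (moment a b g))) k = 0.
Proof.
move=> k; have cg := C_on_continuous (leq0n N) hg.
pose M : {scalar {poly R}} := poly_integral_scalar cg.
have -> : moment a b g = fun l => M 'X^l.
  by apply/funext => l; apply: eq_Rintegral => x _; rewrite hornerXn.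
pose L : {scalar {poly R}} := M \o adjoint N d c.
(* The factor 1 is the initial [u] for [iter_shift_sub_scalar]. *)
have -> : inner_op N d c (fun l => M 'X^l) = fun l => L (1 * 'X^l).
  by rewrite inner_op_scalar; apply/funext => l; rewrite mul1r.
rewrite !iter_shift_sub_scalar mulr1 -exprMn.
(* [L] unfolds to the integral of [adjoint w] against [g], with [w] a multiple of the required
   power. *)
rewrite [LHS](poly_integral_adjoint N d c hab hg) ?dvdp_mulr//.
rewrite /Rintegral integral0_eq// => x xab.
by rewrite hDg// mulr0.
Qed.
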